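(* Let $\Lambda$ be a compact minimal set of a $C^0$ flow on a connected manifold $M$. Then, either (1) there is a sequence of Lyapunov unstable compact minimal sets $\Lambda_n$ converging to $\Lambda$ in the Hausdorff metric, or (2) $\Lambda$ is an attractor (i.e. asymptotically stable), or (3) there are arbitrarily small compact, connected, (+)invariant neighbourhoods $U$ of $\Lambda$ in $M$ such that: (a) the (compact) minimal sets contained in $U$ are all Lyapunov stable and, endowed with the Hausdorff metric, their set is a Peano continuum with $\mathfrak{c}=|\mathbb{R}|$ elements; (b) for each $x\in U$, $\omega(x)$ is a (Lyapunov stable compact) minimal set contained in $U$, and if $x\notin\omega(x)$, then the negative orbit of $x$ leaves $U$ and never returns again, i.e. there is $T\le 0$ such that $x^t\notin U$ for all $t<T$ and $x^t\in U$ for all $t\ge T$.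
   Context: An $n$-manifold is a separable metric space locally homeomorphic to the $n$-cell $\mathbb{D}^n=\{x\in\mathbb{R}^n:|x|\le 1\}$ (possibly noncompact, possibly with boundary). A $C^0$ flow on $M$ is a continuous action of $(\mathbb{R},+)$ on $M$, written $(t,x)\mapsto x^t$; $\omega(x)=\bigcap_{T\ge 0}\overline{\{x^t:t\ge T\}}$. A minimal set is a nonempty closed invariant set containing no smaller nonempty closed invariant set. A set $V$ is (+)invariant if $x^t\in V$ for all $x\in V$, $t\ge0$. A neighbourhood of a set $Y$ is a set whose interior contains $Y$. ''Arbitrarily small neighbourhoods $U$ of $\Lambda$ with property P'' means that every neighbourhood of $\Lambda$ contains a neighbourhood $U$ of $\Lambda$ with property P. A nonempty compact invariant set $K$ is Lyapunov stable if every neighbourhood of $K$ contains a (+)invariant neighbourhood of $K$; otherwise it is Lyapunov unstable. $K$ is an attractor if it is Lyapunov stable and $\{x\in M:\emptyset\ne\omega(x)\subset K\}$ is a neighbourhood of $K$. A Peano continuum is a compact, connected and locally connected metric space. *)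

(* Defs.v *)
From HB Require Import structures.
From mathcomp Require Import all_boot all_order all_algebra.
From mathcomp Require Import all_classical all_reals all_analysis.

Set Implicit Arguments.
Unset Strict Implicit.
Unset Printing Implicit Defensive.

Import Order.TTheory GRing.Theory Num.Theory.
Import numFieldNormedType.Exports.

Local Open Scope classical_set_scope.
Local Open Scope ring_scope.

(* The Euclidean norm is written out because the norm on 'rV[R]_n is the sup
   norm. *)
Definition n_cell (R : realType) (n : nat) : set 'rV[R]_n :=
  [set v | Num.sqrt (\sum_(i < n) v ord0 i ^+ 2) <= 1].
Arguments n_cell : clear implicits.

Definition homeomorphic {X Y : topologicalType} (A : set X) (B : set Y) :=
  exists (f : X -> Y) (g : Y -> X),
    [/\ forall x, A x -> B (f x) /\ g (f x) = x,
        forall y, B y -> A (g y) /\ f (g y) = y,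
        {within A, continuous f} & {within B, continuous g}].

Definition separable (T : topologicalType) :=
  exists2 D : set T, countable D & dense D.

(* [n_cell R n `&` W] is an arbitrary relatively open subset of the closed
   cell; boundary points of the manifold are sent to the unit sphere. *)
Definition manifold {R : realType} (n : nat) (M : metricType R) :=
  separable M /\
  forall x : M, exists (U : set M) (W : set 'rV[R]_n),
    [/\ open U, U x, open W & homeomorphic U (n_cell R n `&` W)].

(* Local connectedness and Peano continua are stated for a subset in its
   relative topology, that is, with the restricted metric. *)
Definition locally_connected {T : topologicalType} (A : set T) :=
  forall (x : T) (V : set T), A x -> open V -> V x ->
    exists W : set T, [/\ open W, W x, A `&` W `<=` V & connected (A `&` W)].

Definition peano_continuum {R : realType} {T : metricType R} (A : set T) :=
  [/\ compact A, connected A & locally_connected A].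

Record compacts {R : realType} (M : metricType R) := Compacts {
  compacts_set :> set M ;
  compacts_compact : compact compacts_set ;
  compacts_nonempty : compacts_set !=set0 }.

Section Hausdorff.
Context {R : realType} {M : metricType R}.

Definition thickening (A : set M) (e : R) : set M := \bigcup_(a in A) ball a e.

Definition hausdorff_radii (A B : set M) : set R :=
  [set e | [/\ 0 < e, A `<=` thickening B e & B `<=` thickening A e]].

Definition hausdorff_dist (A B : compacts M) : R := inf (hausdorff_radii A B).

Let radii_lb (A B : set M) : lbound (hausdorff_radii A B) 0.
Proof. by move=> e [/ltW]. Qed.

Let radii_neq0 (A B : compacts M) : hausdorff_radii A B !=set0.
Proof.
have bnd (K : compacts M) (x : M) :
    \forall r \near pinfty_nbhs R, (K : set M) `<=` (fun y => ball x r y).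
  have /compact_near_coveringP cK := @compacts_compact _ _ K.
  apply: (cK R (pinfty_nbhs R) (fun r y => ball x r y)) => y Ky.
  exists (ball y 1, [set r | mdist x y + 1 < r]); first split => /=.
  - exact: nbhsx_ballx.
  - by apply: nbhs_pinfty_gt; exact: num_real.
  - move=> [z r] /= [yz xyr]; move: yz; rewrite !ballEmdist /= => yz.
    rewrite (le_lt_trans (metric_triangle _ y _))// (lt_trans _ xyr)//.
    by rewrite ltrD2l.
have [a Aa] := @compacts_nonempty _ _ A.
have [b Bb] := @compacts_nonempty _ _ B.
near (pinfty_nbhs R) => r; exists r; split.
- by near: r; exact: nbhs_pinfty_gt.
- by move=> x Ax; exists b => //; move: x Ax; near: r; exact: bnd.
- by move=> x Bx; exists a => //; move: x Bx; near: r; exact: bnd.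
Unshelve. all: by end_near. Qed.

Let has_inf_radii (A B : compacts M) : has_inf (hausdorff_radii A B).
Proof. by split; [exact: radii_neq0 | exists 0; exact: radii_lb]. Qed.

Let hausdorff_dist_ge0 A B : 0 <= hausdorff_dist A B.
Proof. by apply: lb_le_inf; [exact: radii_neq0 | exact: radii_lb]. Qed.

Let hausdorff_dist_sym A B : hausdorff_dist A B = hausdorff_dist B A.
Proof. by congr inf; apply/seteqP; split => e [e0 AB BA]; split. Qed.

Let hausdorff_distxx A : hausdorff_dist A A = 0.
Proof.
apply/eqP; rewrite eq_le hausdorff_dist_ge0 andbT.
apply/ler_addgt0Pl => e e0; rewrite addr0.
by apply: ge_inf; [exists 0; exact: radii_lb | split => // x Ax; exists x => //;
  exact: ballxx].
Qed.

Let hausdorff_dist_eq0_sub (A B : compacts M) :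
  hausdorff_dist A B = 0 -> (A : set M) `<=` B.
Proof.
move=> AB0 x Ax.
have /closure_id -> : closed (B : set M).
  by apply: compact_closed; [exact: metric_hausdorff | exact: compacts_compact].
move=> V /nbhs_ballP[e /= e0 xeV].
have [r [r0 AB _]] : exists2 r, hausdorff_radii A B r & r < hausdorff_dist A B + e.
  exact: inf_adherent.
rewrite AB0 add0r => re; have [b Bb bx] := AB _ Ax.
exists b; split => //; apply: xeV; apply: ball_sym.
exact: le_ball (ltW re) _ bx.
Qed.

Let hausdorff_dist_positivity A B : hausdorff_dist A B = 0 -> A = B.
Proof.
move=> AB0; have : (A : set M) = B.
  by apply/seteqP; split; apply: hausdorff_dist_eq0_sub => //;
    rewrite hausdorff_dist_sym.
move: A B {AB0} => [A cA nA] [B cB nB] /= AB; case: _ / AB cB nB => cB nB.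
by congr Compacts; exact: Prop_irrelevance.
Qed.

Let hausdorff_dist_triangle B A C :
  hausdorff_dist A C <= hausdorff_dist A B + hausdorff_dist B C.
Proof.
apply/ler_addgt0Pl => e e0.
have e20 : 0 < e / 2 by rewrite divr_gt0.
have [r [r0 AB BA] rlt] := inf_adherent e20 (has_inf_radii A B).
have [s [s0 BC CB] slt] := inf_adherent e20 (has_inf_radii B C).
rewrite [e]splitr addrACA; apply: (@le_trans _ _ (r + s)); last first.
  by rewrite lerD// addrC ltW.
apply: ge_inf; first by exists 0; exact: radii_lb.
split; first exact: addr_gt0.
- move=> x /AB[b /BC[c Cc cb] bx]; exists c => //; rewrite /= addrC.
  exact: ball_triangle cb bx.
- move=> x /CB[b /BA[a Aa ab] bx]; exists a => //.
  exact: ball_triangle ab bx.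
Qed.

HB.instance Definition _ := gen_eqMixin (compacts M).
HB.instance Definition _ := gen_choiceMixin (compacts M).
HB.instance Definition _ := isMetric.Build R (compacts M) hausdorff_distxx
  hausdorff_dist_positivity hausdorff_dist_sym hausdorff_dist_triangle.

End Hausdorff.

Section Flows.
Context {R : realType} {M : metricType R}.

Definition flow (phi : R -> M -> M) :=
  [/\ continuous (fun tx : R * M => phi tx.1 tx.2),
      forall x, phi 0 x = x &
      forall s t x, phi (s + t) x = phi t (phi s x)].

Variable phi : R -> M -> M.

Definition invariant (A : set M) := forall x t, A x -> A (phi t x).

Definition pos_invariant (A : set M) :=
  forall x t, A x -> 0 <= t -> A (phi t x).

Definition omega_limit (x : M) : set M :=
  \bigcap_(T in [set T : R | 0 <= T])
    closure [set phi t x | t in [set t | T <= t]].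

Definition minimal_set (A : set M) :=
  [/\ A !=set0, closed A, invariant A &
      forall B : set M, B !=set0 -> closed B -> invariant B ->
        B `<=` A -> B = A].

(* Only meant for nonempty compact invariant [K]. *)
Definition lyapunov_stable (K : set M) :=
  forall N : set M, K `<=` N^° ->
    exists V : set M, [/\ V `<=` N, K `<=` V^° & pos_invariant V].

Definition attractor (K : set M) :=
  lyapunov_stable K /\
  K `<=` [set x | omega_limit x !=set0 /\ omega_limit x `<=` K]^°.

Definition minimal_sets_in (U : set M) : set (compacts M) :=
  [set K | minimal_set K /\ K `<=` U].

End Flows.

(* Main.v *)
Require Import Defs.
From HB Require Import structures.
From mathcomp Require Import all_boot all_order all_algebra.
From mathcomp Require Import all_classical all_reals all_analysis.
From mathcomp Require Import finmap ring lra.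

Set Implicit Arguments.
Unset Strict Implicit.
Unset Printing Implicit Defensive.

Import Order.TTheory GRing.Theory Num.Theory.
Import numFieldNormedType.Exports.

Local Open Scope classical_set_scope.
Local Open Scope ring_scope.

(** If [Lam] is not a limit of unstable compact minimal sets, every compact
minimal set close to [Lam] is Lyapunov stable; [Lam] itself is, since otherwise
the constant sequence at [Lam] would be such a limit.  Closeness can be tested
by inclusion: an invariant set contained in a small neighbourhood of a compact
minimal set is close to it for the Hausdorff metric, because an orbit that
passes near the minimal set comes close to each of its points
([minimal_hausdorff_nbhd]).  Hence there is a compact neighbourhood [P] of [Lam]
all of whose minimal subsets are stable.

Stability of the minimal sets determines the dynamics inside [P].  If the
forward orbit of [x] stays in [P], its limit set contains a minimal set, and
stability of the latter forces equality ([omega_trapped]).  If the whole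
backward orbit of [x] stays in [P], it accumulates on a stable minimal set,
which must then contain [x] ([backward_trapped]); so a point outside its own
limit set leaves [P] in negative time.  Finally, [x |-> omega x] is continuous
for the Hausdorff metric wherever forward orbits stay in [P]
([omega_map_continuous]).

Now let [V] be a positively invariant neighbourhood of [Lam] inside [P], and let
[Q], contained in [V], be a finite union of small convex cells of charts covering
[Lam]: it is compact, connected and locally connected.  The neighbourhood sought
is the closure [U] of the forward orbit of [Q].  The image of [Q] under the
continuous map [omega] is compact, hence closed, so passing to the forward orbit
and then to its closure creates no new limit set: the minimal sets in [U] are
exactly the values of [omega] on [Q].  They therefore form a Peano continuum, a
continuous image of [Q] ([locally_connected_image]).  If [Lam] were the only
one, it would attract a neighbourhood and be an attractor; otherwise the
connected space of minimal sets has at least as many points as an interval, and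
at most as many as the separable metric space [M], because distinct minimal sets
are disjoint ([connected_card_ge], [separable_card_le]). *)

(** * Connectedness and local connectedness *)

Lemma closure_min (T : topologicalType) (A B : set T) :
  closed B -> A `<=` B -> closure A `<=` B.
Proof. by move=> cB AB; rewrite (closure_id B).1//; exact: closureS. Qed.

Lemma connected_bouquet (T : topologicalType) I (A : set T) (D : set I)
    (B : I -> set T) :
  connected A -> (forall i, D i -> connected (B i) /\ A `&` B i !=set0) ->
  connected (A `|` \bigcup_(i in D) B i).
Proof.
move=> cA AB; have [[i0 Di0]|D0] := pselect (exists i, D i); last first.
  have -> : D = set0 by apply/seteqP; split => // i Di; case: D0; exists i.
  by rewrite bigcup_set0 setU0.
have -> : A `|` \bigcup_(i in D) B i = \bigcup_(i in D) (A `|` B i).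
  apply/seteqP; split => [x [Ax|[i Di Bx]]|x [i Di [Ax|Bx]]].
  - by exists i0 => //; left.
  - by exists i => //; right.
  - by left.
  - by right; exists i.
apply: bigcup_connected => [|i /AB[cB ABi]]; last exact: connectedU.
have [_ [a [Aa _]]] := AB _ Di0.
by exists a => i _; left.
Qed.

(** Openness of components is what passes to the image.  The component [Q] of [x]
in a relatively open part of the image pulls back to a relatively open subset of
each [C i], as it absorbs the image of every small connected piece that it
meets; the complement of [Q] in the image is then a finite union of compact
sets. *)
Lemma locally_connected_image (X T : topologicalType) (I : choiceType)
    (D : {fset I}) (C : I -> set X) (h : I -> X -> T) :
  hausdorff_space T ->
  (forall i, i \in D -> [/\ compact (C i), locally_connected (C i) &
     {within C i, continuous (h i)}]) ->
  locally_connected (\bigcup_(i in [set` D]) (h i @` C i)).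
Proof.
move=> hT hC x V; set A := \bigcup_(i in _) _ => Ax oV Vx.
pose Q := connected_component (A `&` V) x.
have QAV : Q `<=` A `&` V by exact: connected_component_sub.
(* The largest open set whose trace on [C i] is mapped into [Q]. *)
pose O i := \bigcup_(W in [set W | open W /\ C i `&` W `<=` h i @^-1` Q]) W.
pose F i := h i @` (C i `&` ~` O i).
have clF i : i \in D -> closed (F i).
  move=> /hC[cC _ ch]; apply: compact_closed => //.
  apply: continuous_compact.
    by apply: continuous_subspaceW ch => ? [].
  apply: compact_closedI => //; apply: open_closedC.
  by apply: bigcup_open => W [].
have AQ : A `&` ~` (\bigcup_(i in [set` D]) F i) = Q.
  apply/seteqP; split => [_ [[i Di [c Cc <-]] nF]|y Qy].
    apply: contrapT => nQ; apply: nF; exists i => //; exists c => //; split => //.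
    by move=> [W [_ WQ] Wc]; apply: nQ; apply: WQ.
  have [Ay Vy] := QAV _ Qy; split => //.
  move=> [i Di [c [Cc nO] hcy]]; apply: nO.
  have [_ lC ch] := hC i Di.
  have /subspace_continuousP/(_ c Cc) chc := ch.
  have : nbhs (h i c) V by rewrite hcy; exact: open_nbhs_nbhs.
  move=> /chc; rewrite /nbhs/= /within/= => nV.
  have [W [oW Wc CWV cCW]] := lC c _ Cc (open_interior _) nV.
  exists W => //; split => // d [Cd Wd]; rewrite /preimage/=.
  apply: (connected_component_trans Qy).
  apply: (@connected_component_max _ _ (h i @` (C i `&` W))).
  - by exists c.
  - move=> _ [e [Ce We] <-]; split; first by exists i => //; exists e.
    by have /interior_subset := CWV _ (conj Ce We); exact.
  - apply: connected_continuous_connected => //.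
    by apply: continuous_subspaceW ch => ? [].
  - by exists d.
exists (~` (\bigcup_(i in [set` D]) F i)); split.
- apply: closed_openC; apply: closed_bigcup => //; exact: finite_fset.
- have : Q x by apply: connected_component_refl.
  by rewrite -AQ => -[].
- by rewrite AQ => y /QAV[].
- by rewrite AQ; exact: component_connected.
Qed.

(** * Cardinality of metric spaces *)

Definition ternary_sum (R : realType) (S : set nat) (n : nat) : R :=
  \sum_(k < n) (if `[< S k >] then 3 ^- k else 0).

(** Ternary expansions with digits 0 and 1 are injective: at the first
disagreement [k] the term [3 ^- k] exceeds all that can follow it, which is at
most [3 ^- k / 2]. *)
Lemma set_nat_card_le (R : realType) : ([set: set nat] #<= [set: R])%card.
Proof.
pose s := @ternary_sum R.
have p3 k : 0 < 3 ^- k :> R by rewrite invr_gt0 exprn_gt0.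
have e3 k : 3 ^- k = 3 * 3 ^- k.+1 :> R.
  by rewrite exprS invfM mulrA mulfV ?mul1r.
have sS S n : s S n.+1 = s S n + (if `[< S n >] then 3 ^- n else 0).
  by rewrite /s /ternary_sum big_ord_recr.
have s_le S n m : s S n <= s S (n + m)%N.
  elim: m => [|m IH]; first by rewrite addn0.
  rewrite addnS sS; apply: (le_trans IH); rewrite lerDl.
  by case: ifP => // _; exact: ltW.
have t_ge S n m : s S (n + m)%N + 3 / 2 * 3 ^- (n + m) <= s S n + 3 / 2 * 3 ^- n.
  elim: m => [|m IH]; first by rewrite addn0.
  apply: le_trans IH; rewrite addnS sS.
  have := e3 (n + m)%N; have := p3 (n + m).+1.
  by case: ifP => _; lra.
have s_ub S n m : s S m <= s S n + 3 / 2 * 3 ^- n.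
  have := t_ge S n m; have := s_le S m n; have := p3 (n + m)%N.
  rewrite (addnC m); lra.
pose f (S : set nat) : R := sup (range (s S)).
have sf S n : s S n <= f S.
  apply: ub_le_sup; last by exists n.
  by exists (s S 0 + 3 / 2 * 3 ^- 0) => _ [m _ <-]; exact: s_ub.
have fs S n : f S <= s S n + 3 / 2 * 3 ^- n.
  apply: ge_sup; first by exists (s S 0); exists 0.
  by move=> _ [m _ <-]; exact: s_ub.
have ord (S S' : set nat) k : (forall j, (j < k)%N -> S j <-> S' j) ->
    S k -> ~ S' k -> f S' < f S.
  move=> agree Sk S'k.
  have eqs : s S k = s S' k.
    apply: eq_bigr => i _; case: (agree i (ltn_ord i)) => a b.
    by congr (if _ then _ else _); apply/asboolP/asboolP.
  have := sf S k.+1; have := fs S' k.+1; rewrite !sS eqs.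
  rewrite (asboolT Sk) (asboolF S'k).
  have := e3 k; have := p3 k.+1; lra.
apply/pcard_injP; exists f => S S' _ _ fSS.
apply: contrapT => SS'.
have ex : exists n, `[< S n <> S' n >].
  apply: contrapT => nex; apply: SS'; apply/funext => n; apply: contrapT => ne.
  by apply: nex; exists n; apply/asboolP.
case: (ex_minnP ex) => k /asboolP ne kmin.
have agree j : (j < k)%N -> S j <-> S' j.
  move=> jk; have -> // : S j = S' j.
  by apply: contrapT => /asboolP/kmin; rewrite leqNgt jk.
have [Sk|nSk] := pselect (S k).
  have nS'k : ~ S' k by move=> S'k; apply: ne; apply/propext; split.
  by have := ord S S' k agree Sk nS'k; rewrite fSS ltxx.
have S'k : S' k.
  by apply: contrapT => nS'k; apply: ne; apply/propext; split.
have := ord S' S k (fun j jk => iff_sym (agree j jk)) S'k nSk.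
by rewrite fSS ltxx.
Qed.

(** A point is determined by the balls of radius [1 / (k + 1)] around the
points of a countable dense set that contain it, and these balls are coded by
natural numbers. *)
Lemma separable_card_le (R : realType) (M : metricType R) :
  separable M -> ([set: M] #<= [set: R])%card.
Proof.
move=> [D /pcard_injP[i iinj] dD].
apply: (card_le_trans _ (@set_nat_card_le R)).
pose c (x : M) : set nat := [set m | exists2 d, D d & exists k : nat,
  mdist d x < k.+1%:R^-1 /\ m = choice.pickle (i d : nat, k)].
apply/pcard_injP; exists c => x y _ _ cxy.
apply: contrapT => xy.
have pos : 0 < mdist x y / 2 by rewrite divr_gt0// mdist_gt0; apply/eqP.
have [k kxy] : exists k : nat, k.+1%:R^-1 < mdist x y / 2.
  exists (Num.truncn (mdist x y / 2)^-1).
  rewrite invf_plt ?posrE// truncnS_gt//.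
have [||d [/interior_subset]] := dD (ball x k.+1%:R^-1)°.
- by exists x; apply: nbhsx_ballx; rewrite invr_gt0 ltr0n.
- exact: open_interior.
rewrite ballEmdist/= metric_sym => dx Dd.
have : c x (choice.pickle (i d : nat, k)) by exists d => //; exists k.
rewrite cxy => -[e De [l [ey /(pcan_inj choice.pickleK)[ide kl]]]].
move: ey; rewrite -kl.
have <- : d = e by apply: iinj => //; exact: mem_set.
have := metric_triangle x d y; rewrite (metric_sym x d).
move: (k.+1%:R^-1) dx kxy => r dx kxy; lra.
Qed.

(** The distance to [a] takes on the connected set [A] every value between [0]
and the distance from [a] to [b], and [contract] embeds the line in an
interval. *)
Lemma connected_card_ge (R : realType) (M : metricType R) (A : set M) (a b : M) :
  connected A -> A a -> A b -> a <> b -> ([set: R] #<= A)%card.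
Proof.
move=> cA Aa Ab ab.
have d0 : 0 < mdist a b by rewrite mdist_gt0; apply/eqP.
have cd : continuous (mdist a : M -> R^o).
  move=> x; apply/cvgrPdist_lt => e e0.
  near=> y.
  have : mdist x y < e.
    have : ball x e y by near: y; exact: nbhsx_ballx.
    by rewrite ballEmdist.
  have := metric_triangle a x y; have := metric_triangle a y x.
  rewrite (metric_sym y x) => h1 h2 h3.
  by rewrite ltr_norml; apply/andP; split; lra.
have itv : is_interval ((mdist a : M -> R^o) @` A).
  apply/connected_intervalP; apply: connected_continuous_connected => //.
  exact: continuous_subspaceT.
have ex (t : R) : exists x, A x /\ mdist a x = mdist a b * ((1 + contract t%:E) / 2).
  have Sa : ((mdist a : M -> R^o) @` A) (mdist a a) by exists a.
  have Sb : ((mdist a : M -> R^o) @` A) (mdist a b) by exists b.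
  have [|x Ax xE] := itv _ _ Sa Sb (mdist a b * ((1 + contract t%:E) / 2)).
    have := contract_le1 t%:E; rewrite ler_norml => /andP[h1 h2].
    rewrite mdistxx; apply/andP; split.
      by apply: mulr_ge0; [exact: ltW|lra].
    by rewrite ger_pMr//; lra.
  by exists x.
have [f fP] := choice ex.
have [g] : $|{injfun [set: R] >-> A}|.
  apply/injfunPex; exists f => [t _|s t _ _ fst]; first by case: (fP t).
  have := (fP s).2; rewrite fst (fP t).2.
  move=> /(mulfI (lt0r_neq0 d0)) h.
  have : contract t%:E = contract s%:E by lra.
  by move=> /contract_inj[].
exact: inj_card_le g.
Unshelve. all: by end_near. Qed.

(** * Convex cells in a manifold *)

Definition convex (R : realType) (V : normedModType R) (A : set V) :=
  forall a b (t : R), A a -> A b -> 0 <= t <= 1 -> A (a + t *: (b - a)).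

Lemma convexI (R : realType) (V : normedModType R) (A B : set V) :
  convex A -> convex B -> convex (A `&` B).
Proof.
move=> cA cB a b t [Aa Ba] [Ab Bb] t01.
by split; [exact: cA|exact: cB].
Qed.

Lemma norm_convex (R : realType) (V : normedModType R) (x a b : V) (t : R) :
  0 <= t <= 1 ->
  `|x - (a + t *: (b - a))| <= (1 - t) * `|x - a| + t * `|x - b|.
Proof.
move=> /andP[t0 t1].
have -> : x - (a + t *: (b - a)) = (1 - t) *: (x - a) + t *: (x - b).
  rewrite scalerBl scale1r -addrA -scalerN -scalerDr opprB addrA subrK.
  by rewrite opprD addrA -scalerN opprB.
apply: (le_trans (ler_normD _ _)); rewrite !normrZ.
by rewrite (ger0_norm t0) ger0_norm ?subr_ge0.
Qed.

Lemma convex_ball (R : realType) (V : normedModType R) (x : V) (e : R) :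
  convex (ball x e).
Proof.
move=> a b t; rewrite -ball_normE/= => ax bx t01.
apply: (le_lt_trans (norm_convex _ _ _ t01)); move: t01 => /andP[t0 t1].
apply: (@le_lt_trans _ _ (Num.max `|x - a| `|x - b|)).
  have : `|x - a| <= Num.max `|x - a| `|x - b| by rewrite le_max lexx.
  have : `|x - b| <= Num.max `|x - a| `|x - b| by rewrite le_max lexx orbT.
  by move: (Num.max _ _) => m; nra.
by rewrite gt_max ax.
Qed.

Lemma convex_closed_ball (R : realType) (V : normedModType R) (x : V) (e : R) :
  0 < e -> convex (closed_ball x e).
Proof.
move=> e0 a b t; rewrite closed_ballE// /closed_ball_/= => ax bx t01.
apply: (le_trans (norm_convex _ _ _ t01)); move: t01 => /andP[]; nra.
Qed.

Lemma convex_connected (R : realType) (V : normedModType R) (A : set V) :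
  convex A -> connected A.
Proof.
move=> cA; have [[a Aa]|A0] := pselect (A !=set0); last first.
  have -> : A = set0 by apply/seteqP; split => // x Ax; case: A0; exists x.
  exact: connected0.
pose seg b := (fun t : R => a + t *: (b - a)) @` `[0, 1].
have -> : A = \bigcup_(b in A) seg b.
  apply/seteqP; split => [b Ab|_ [b Ab [t t01 <-]]].
    exists b => //; exists 1; first by rewrite /= in_itv/= ler01 lexx.
    by rewrite scale1r addrC subrK.
  by apply: cA => //; move: t01; rewrite /= in_itv.
apply: bigcup_connected.
  exists a => b Ab; exists 0; first by rewrite /= in_itv/= lexx ler01.
  by rewrite scale0r addr0.
move=> b Ab; apply: connected_continuous_connected.
  exact: segment_connected.
apply: continuous_subspaceT => t.
by apply: cvgD; [exact: cvg_cst|apply: cvgZr_tmp; exact: cvg_id].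
Qed.

Lemma convex_locally_connected (R : realType) (V : normedModType R) (A : set V) :
  convex A -> locally_connected A.
Proof.
move=> cA x U Ax oU Ux.
have /nbhs_ballP[e /= e0 eU] : nbhs x U by exact: open_nbhs_nbhs.
exists (ball x e); split.
- exact: ball_open.
- exact: ballxx.
- by move=> y [_ /eU].
- by apply: convex_connected; apply: convexI => //; exact: convex_ball.
Qed.

Lemma n_cellE (R : realType) n (v : 'rV[R]_n) :
  n_cell R n v <-> \sum_(i < n) v ord0 i ^+ 2 <= 1.
Proof.
rewrite /n_cell/= -[X in _ <= X]sqrtr1 ler_sqrt//.
Qed.

Lemma n_cell_convex (R : realType) n : convex (n_cell R n).
Proof.
move=> a b t /n_cellE Aa /n_cellE Ab /andP[t0 t1]; apply/n_cellE.
apply: (@le_trans _ _ ((1 - t) * (\sum_(i < n) a ord0 i ^+ 2) +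
  t * (\sum_(i < n) b ord0 i ^+ 2))); last by nra.
rewrite !mulr_sumr -big_split/=; apply: ler_sum => i _.
rewrite !mxE; move: (a ord0 i) (b ord0 i) => x y.
(* The second term on the right is the convexity defect of the square. *)
have -> : (1 - t) * x ^+ 2 + t * y ^+ 2 =
   (x + t * (y - x)) ^+ 2 + t * (1 - t) * (x - y) ^+ 2 by ring.
by rewrite lerDl mulr_ge0 ?sqr_ge0// mulr_ge0// subr_ge0.
Qed.

Lemma n_cell_compact (R : realType) n : compact (n_cell R n).
Proof.
have cl : closed (n_cell R n).
  have -> : n_cell R n =
      (fun v => \sum_(i < n) v ord0 i ^+ 2) @^-1` [set x | x <= 1].
    by apply/seteqP; split => v /n_cellE.
  apply: preimage_closed; last exact: closed_le.
  move=> v _; move: v.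
  apply: (@continuous_big R^o _ +%R 0 xpredT _ _ (index_enum 'I_n)
    (fun i (v : 'rV[R]_n) => v ord0 i ^+ 2)) => [|i _ v].
    exact: add_continuous.
  have /(_ v) cv := @coord_continuous R 1 n ord0 i.
  exact: (cvgM cv cv).
apply: bounded_closed_compact cl.
exists 1; split => // r r1 v /n_cellE v1; apply: (le_trans _ (ltW r1)).
rewrite [leLHS]/Num.norm/= mx_normrE; apply/bigmax_leP; split => // -[j i] _ /=.
rewrite ord1.
  rewrite -(@ler_pXn2r _ 2)// ?nnegrE// expr1n real_normK ?num_real//.
  apply: le_trans v1; rewrite (bigD1 i)//= lerDl.
  by apply: sumr_ge0 => k _; exact: sqr_ge0.
Qed.

(** A small closed ball around the image of [x] in a chart meets the closed unit
cell in a convex compact set, which is a neighbourhood also when [x] is a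
boundary point. *)
Lemma manifold_cell (R : realType) n (M : metricType R) (x : M) (O : set M) :
  manifold n M -> open O -> O x ->
  exists (C : set 'rV[R]_n) (g : 'rV[R]_n -> M),
    [/\ compact C, convex C, {within C, continuous g}, g @` C `<=` O &
        nbhs x (g @` C)].
Proof.
move=> [_ /(_ x)[U [W [oU Ux oW [f [g [fg gf cf cg]]]]]]] oO Ox.
have [[nfx Wfx] gfx] := fg x Ux.
have /subspace_continuousP/(_ (f x) (conj nfx Wfx)) cgx := cg.
have : nbhs (g (f x)) O by rewrite gfx; exact: open_nbhs_nbhs.
move=> /cgx; rewrite /nbhs/= /within/= => gO.
have gOW : \forall v \near f x, n_cell R n v -> W v /\ O (g v).
  near=> v => nv; have Wv : W v by near: v; exact: open_nbhs_nbhs.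
  by split => //; apply: (near gO v).
have [r rgO] := (nbhs_closedballP _ _).1 gOW.
pose B : set 'rV[R]_n := closed_ball (f x) r%:num.
have CgO v : (n_cell R n `&` B) v -> W v /\ O (g v).
  by move=> [nv Bv]; exact: rgO.
exists (n_cell R n `&` B), g; split.
- by apply: compact_closedI; [exact: n_cell_compact|exact: closed_ball_closed].
- by apply: convexI; [exact: n_cell_convex|exact: convex_closed_ball].
- by apply: continuous_subspaceW cg => v Cv; split; [case: Cv|case: (CgO v Cv)].
- by move=> _ [v Cv <-]; case: (CgO v Cv).
- have /subspace_continuousP/(_ x Ux) cfx := cf.
  have : nbhs (f x) B by apply/nbhs_closedballP; exists r.
  move=> /cfx; rewrite /nbhs/= /within/= => fB.
  near=> y; have Uy : U y by near: y; exact: open_nbhs_nbhs.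
  have [[nfy _] gfy] := fg y Uy.
  by exists (f y) => //; split => //; apply: (near fB y).
Unshelve. all: by end_near. Qed.

(** The near covering property of [K], along the filter of large finite subsets
of [K], yields the finite subcover. *)
Lemma compact_fset_cover (T : topologicalType) (K : set T) (f : T -> set T) :
  compact K -> (forall x, K x -> nbhs x (f x)) ->
  exists2 D : {fset T}, [set` D] `<=` K & K `<=` \bigcup_(x in [set` D]) (f x)°.
Proof.
move=> cK fK.
pose F := filter_from [set D : {fset T} | [set` D] `<=` K]
  (fun D => [set E : {fset T} | [set` D] `<=` [set` E]]).
have FF : Filter F.
  apply: filter_from_filter; first by exists fset0 => x; rewrite /= inE.
  move=> D E DK EK; exists (D `|` E)%fset => [x|G DEG].
    by rewrite /= in_fsetU => /orP[/DK|/EK].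
  by split=> x xDE; apply: DEG; rewrite /= in_fsetU xDE ?orbT.
move/compact_near_coveringP: cK => /(_ _ F
  (fun D x => (\bigcup_(y in [set` D]) (f y)°) x) FF) [].
  move=> x Kx; exists ((f x)°, [set D : {fset T} | x \in D]); first split => /=.
  - by apply: nbhs_interior; exact: fK.
  - exists [fset x]%fset => [y|D xD /=]; first by rewrite /= in_fset1 => /eqP->.
    by apply: xD; rewrite /= in_fset1.
  - by move=> [y D] [/= fy xD]; exists x.
by move=> D DK DP; exists D => //; exact: DP.
Qed.

(** Each cell contains its center, a point of [K]; this is what makes the union
of the cells connected when [K] is. *)
Lemma cell_cover (R : realType) n (M : metricType R) (K O : set M) :
  manifold n M -> compact K -> open O -> K `<=` O ->
  exists (D : {fset M}) (C : M -> set 'rV[R]_n) (g : M -> 'rV[R]_n -> M),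
    [/\ forall x, x \in D -> K x /\ [/\ compact (C x), convex (C x),
          {within C x, continuous (g x)}, g x @` C x `<=` O & (g x @` C x) x],
        compact (\bigcup_(x in [set` D]) (g x @` C x)) &
        K `<=` (\bigcup_(x in [set` D]) (g x @` C x))°].
Proof.
move=> mM cK oO KO.
have ex (x : M) : exists Cg : set 'rV[R]_n * ('rV[R]_n -> M), K x ->
    [/\ compact Cg.1, convex Cg.1, {within Cg.1, continuous Cg.2},
      Cg.2 @` Cg.1 `<=` O & nbhs x (Cg.2 @` Cg.1)].
  have [Kx|nKx] := pselect (K x); last first.
    by exists (set0, (fun=> x)).
  have [C [g Cg]] := manifold_cell mM oO (KO _ Kx).
  by exists (C, g).
have [Cg CgP] := choice ex.
have [|D DK Dcov] := compact_fset_cover (f := fun x => (Cg x).2 @` (Cg x).1) cK.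
  by move=> x /CgP[].
exists D, (fun x => (Cg x).1), (fun x => (Cg x).2); split.
- move=> x /DK Kx; split => //.
  by case: (CgP x Kx) => ? ? ? ? /nbhs_singleton.
- rewrite bigcup_fset big_seq; apply: bigsetU_compact => x /DK /CgP[cC _ gc _ _].
  exact: continuous_compact.
- move=> x /Dcov[y Dy]; apply: interiorS => z Cz.
  by exists y.
Qed.

(** * Limit sets and minimal sets *)

Section FlowTheory.
Context {R : realType} {M : metricType R}.
Implicit Types (phi : R -> M -> M) (K A B O U : set M) (x y : M).

Lemma flow_continuous phi t : flow phi -> continuous (phi t).
Proof.
move=> [cphi _ _] x.
have tx : (t, y) @[y --> x] --> (t, x).
  by apply: (@cvg_pair _ _ _ _ (nbhs t) (nbhs x)); [exact: cvg_cst|exact: cvg_id].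
exact: (cvg_comp _ _ tx (cphi (t, x))).
Qed.

Lemma orbit_continuous phi x : flow phi -> continuous (phi^~ x).
Proof.
move=> [cphi _ _] t.
have tx : (s, x) @[s --> t] --> (t, x).
  by apply: (@cvg_pair _ _ _ _ (nbhs t) (nbhs x)); [exact: cvg_id|exact: cvg_cst].
exact: (cvg_comp _ _ tx (cphi (t, x))).
Qed.

Lemma flowN phi t x : flow phi -> phi t (phi (- t) x) = x.
Proof. by move=> [_ p0 pD]; rewrite -pD addNr p0. Qed.

Lemma flow_opp phi : flow phi -> flow (fun t => phi (- t)).
Proof.
move=> [cphi p0 pD]; split => [p|x|s t x].
- have Np : (- q.1, q.2) @[q --> p] --> (- p.1, p.2).
    apply: (@cvg_pair _ _ _ _ (nbhs (- p.1)) (nbhs p.2)).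
      by apply: cvgN; exact: cvg_fst.
    exact: cvg_snd.
  exact: (cvg_comp _ _ Np (cphi (- p.1, p.2))).
- by rewrite oppr0 p0.
- by rewrite opprD pD.
Qed.

Lemma closure_maps (f : M -> M) A B :
  continuous f -> (forall x, A x -> B (f x)) ->
  forall x, closure A x -> closure B (f x).
Proof.
move=> cf AB; apply: (@closure_min _ A (f @^-1` closure B)).
  by apply: preimage_closed; [move=> x _; exact: cf|exact: closed_closure].
by move=> x /AB; exact: subset_closure.
Qed.

Lemma closure_invariant phi A : flow phi -> Defs.invariant phi A ->
  Defs.invariant phi (closure A).
Proof.
move=> fphi iA x t; apply: closure_maps; first exact: flow_continuous.
by move=> y; exact: iA.
Qed.

Lemma closure_pos_invariant phi A : flow phi -> pos_invariant phi A ->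
  pos_invariant phi (closure A).
Proof.
move=> fphi iA x t Ax t0; move: x Ax.
by apply: closure_maps; [exact: flow_continuous|move=> y Ay; exact: iA].
Qed.

Lemma omega_closed phi x : closed (omega_limit phi x).
Proof. by apply: closed_bigI => T _; exact: closed_closure. Qed.

Lemma omega_invariant phi x : flow phi -> Defs.invariant phi (omega_limit phi x).
Proof.
move=> fphi y t wy T /= T0.
pose T' := Num.max 0 (T - t).
have := wy T'; rewrite /= le_max lexx => /(_ isT).
apply: closure_maps; first exact: flow_continuous.
move=> _ [s /= Ts <-]; exists (s + t).
  by move: Ts; rewrite /T' ge_max => /andP[_]; rewrite lerBlDr.
by case: fphi => _ _ ->.
Qed.

Lemma omega_sub phi x B s : closed B -> (forall t, s <= t -> B (phi t x)) ->
  omega_limit phi x `<=` B.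
Proof.
move=> cB sB y /(_ (Num.max 0 s)); rewrite /= le_max lexx => /(_ isT).
apply: closure_min => // _ [t /= + <-].
by rewrite ge_max => /andP[_]; exact: sB.
Qed.

(** A cluster point at infinity of the orbit, which eventually stays in the
compact set [B]. *)
Lemma omega_nonempty phi x B s : compact B ->
  (forall t, s <= t -> B (phi t x)) -> omega_limit phi x !=set0.
Proof.
move=> cB sB.
have [|p [_ Fp]] := cB (phi^~ x @ +oo) _.
  by exists s; split; [exact: num_real|move=> t st; apply: sB; exact: ltW].
exists p => T /= T0; move: Fp; rewrite clusterE.
apply; exists T; split; first exact: num_real.
by move=> t Tt; exists t => //=; exact: ltW.
Qed.

Lemma omega_shift phi t x : flow phi ->
  omega_limit phi (phi t x) `<=` omega_limit phi x.
Proof.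
move=> [_ _ pD] y wy T /= T0.
pose T' := Num.max 0 (T - t).
have := wy T'; rewrite /= le_max lexx => /(_ isT).
apply: closureS => _ [s /= Ts <-]; exists (t + s); last exact: pD.
by move: Ts; rewrite /T' ge_max => /andP[_] /=; rewrite lerBlDl.
Qed.

Lemma omega_minimal phi K x : flow phi -> minimal_set phi K -> compact K ->
  K x -> omega_limit phi x = K.
Proof.
move=> fphi [_ clK iK mK] cK Kx; apply: mK.
- by apply: (@omega_nonempty _ _ K 0) => // t _; exact: iK.
- exact: omega_closed.
- exact: omega_invariant.
- by apply: (@omega_sub _ _ _ 0) => // t _; exact: iK.
Qed.

Lemma minimal_meet phi A B : minimal_set phi A -> minimal_set phi B ->
  A `&` B !=set0 -> A = B.
Proof.
move=> [_ cA iA mA] [_ cB iB mB] AB.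
have iAB : Defs.invariant phi (A `&` B).
  by move=> x t [Ax Bx]; split; [exact: iA|exact: iB].
have cAB : closed (A `&` B) by exact: closedI.
rewrite -[LHS](mA (A `&` B))//; first by apply: mB => // x [].
Qed.

(** A minimal set is the closure of any of its orbits. *)
Lemma minimal_connected phi K : flow phi -> minimal_set phi K -> connected K.
Proof.
move=> fphi [[x Kx] clK iK mK].
rewrite -(mK (closure (range (phi^~ x)))).
- apply: connected_closure; apply: connected_continuous_connected.
    by apply/connected_intervalP.
  by apply: continuous_subspaceT; exact: orbit_continuous.
- by exists x; apply: subset_closure; exists 0 => //; case: fphi.
- exact: closed_closure.
- apply: closure_invariant => // _ t [s _ <-]; exists (s + t) => //.
  by case: fphi.
- by apply: closure_min => // _ [t _ <-]; exact: iK.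
Qed.

(** Zorn's lemma for complements: the open sets [A] whose complement is invariant
and that do not contain [K] are closed under unions of chains, since [K] is
compact; the complement in [K] of a maximal one is minimal. *)
Lemma exists_minimal phi K : compact K -> K !=set0 -> Defs.invariant phi K ->
  exists2 L, L `<=` K & minimal_set phi L.
Proof.
move=> cK K0 iK.
have clK : closed K by apply: compact_closed => //; exact: metric_hausdorff.
pose P (A : set M) := [/\ open A, (forall x t, A (phi t x) -> A x) & ~ (K `<=` A)].
have [F FP Ftot|A [[oA iA nKA] Amax]] := @Zorn_bigcup M P.
  split.
  - by apply: bigcup_open => A /FP[].
  - by move=> x t [A FA Ax]; exists A => //; have [_ iA _] := FP _ FA; exact: iA Ax.
  - move=> KF.
    have ex (x : M) : exists A, K x -> F A /\ A x.
      have [/KF[A FA Ax]|nKx] := pselect (K x); first by exists A.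
      by exists set0.
    have [f fP] := choice ex.
    have [|D DK Dcov] := compact_fset_cover (f := f) cK.
      move=> x Kx; have [Ff fx] := fP x Kx.
      by apply: open_nbhs_nbhs; split => //; case: (FP _ Ff).
    (* A finite part of a chain has an upper bound in the chain. *)
    have : exists2 A, F A & forall x, x \in D -> f x `<=` A.
      have : forall x, x \in D -> K x by move=> x /DK.
      elim/finSet_rect: D {DK Dcov} => D IH DK.
      have [->|[d dD]] := fset_0Vmem D.
        have [x Kx] := K0; exists (f x); first by case: (fP x Kx).
        by move=> y; rewrite inE.
      have [|z|A FA DA] := IH (D `\ d)%fset; first exact: fproperD1.
        by rewrite in_fsetD1 => /andP[_]; exact: DK.
      have Kd := DK d dD.
      have [Fd _] := fP d Kd.
      have [Afd|fdA] := Ftot _ _ FA Fd.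
        exists (f d) => // x xD; have [->//|xd] := eqVneq x d.
        by apply: subset_trans Afd; apply: DA; rewrite in_fsetD1 xd.
      exists A => // x xD; have [->//|xd] := eqVneq x d.
      by apply: DA; rewrite in_fsetD1 xd.
    move=> [A FA DA]; have [_ _] := FP _ FA; apply.
    by move=> x /Dcov[y Dy] /interior_subset; exact: DA.
exists (K `&` ~` A); first by move=> x [].
have cKA : closed (K `&` ~` A) by apply: closedI => //; exact: open_closedC.
split => //.
- apply: contrapT => nE; apply: nKA => x Kx; apply: contrapT => nAx.
  by apply: nE; exists x.
- by move=> x t [Kx nAx]; split; [exact: iK|move=> /iA].
- move=> B B0 cB iB BKA; apply/seteqP; split => // x [Kx nAx].
  apply: contrapT => nBx; apply: (Amax (~` B)).
    split; last by move=> /(_ x nBx).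
    by move=> y Ay By; have [_] := BKA y By.
  split; first exact: closed_openC.
    by move=> y t nBy By; apply: nBy; exact: iB.
  by have [b Bb] := B0; have [Kb _] := BKA b Bb; move=> /(_ b Kb).
Qed.

End FlowTheory.

(** * Lyapunov stable minimal sets *)

Lemma closed_nbhd_within (R : realType) (M : metricType R) (K O : set M) :
  closed K -> open O -> K `<=` O ->
  exists N : set M, [/\ closed N, K `<=` N° & N `<=` O].
Proof.
move=> cK oO KO.
have := @pseudometric_normal R M.
move=> /(@normal_openP R)/(_ K (~` O) cK (open_closedC oO)) [].
  by apply/seteqP; split => // x [/KO].
move=> A [B [oA oB KA OB AB]].
exists (~` B); split.
- exact: open_closedC.
- move=> x Kx; apply: (@filterS _ _ _ A); last first.
    by apply: open_nbhs_nbhs; split => //; exact: KA.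
  by move=> y Ay By; have : (A `&` B) y by []; rewrite AB.
- by move=> x nBx; apply: contrapT => /OB.
Qed.

Section Stability.
Context {R : realType} {M : metricType R}.
Variable phi : R -> M -> M.
Hypothesis fphi : flow phi.
Implicit Types (K A B O U P : set M) (x y : M).

(** Once the orbit of [x] enters a small positively invariant neighbourhood of
[K], so do the orbits of all points near [x], at the same time, and they never
leave it. *)
Lemma stable_attracts K O x : closed K -> lyapunov_stable phi K ->
  open O -> K `<=` O -> omega_limit phi x `&` K !=set0 ->
  exists B s, [/\ closed B, B `<=` O &
    \forall y \near x, forall t, s <= t -> B (phi t y)].
Proof.
move=> cK sK oO KO [k [wk Kk]].
have [N [cN KN NO]] := closed_nbhd_within cK oO KO.
have [V [VN KV iV]] := sK N KN.
have [_ [[s /= s0 <-] Vs]] := wk 0 (lexx _) _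
  (open_nbhs_nbhs (conj (open_interior V) (KV _ Kk))).
exists N, s; split => //.
have nV : nbhs (phi s x) V by exact: Vs.
have := flow_continuous fphi nV; rewrite /nbhs/= => nxV.
near=> y => t st; apply: VN.
have -> : phi t y = phi (t - s) (phi s y).
  by case: fphi => _ _ <-; rewrite addrC subrK.
apply: iV; last by rewrite subr_ge0.
by near: y.
Unshelve. all: by end_near. Qed.

(** By [stable_attracts], the limit set avoids each point outside [K]. *)
Lemma omega_stable K x : minimal_set phi K -> lyapunov_stable phi K ->
  K `<=` omega_limit phi x -> omega_limit phi x = K.
Proof.
move=> [[k Kk] cK _ _] sK Kw; apply/seteqP; split => // y wy.
apply: contrapT => nKy.
have oy : open (~` [set y]).
  apply: closed_openC; apply: compact_closed; first exact: metric_hausdorff.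
  exact: compact_set1.
have [||B [s [cB By nB]]] := stable_attracts cK sK oy _ (x := x).
- by move=> z Kz /= zy; apply: nKy; rewrite -zy.
- by exists k; split => //; exact: Kw.
have := omega_sub cB (nbhs_singleton nB) wy.
by move=> /By; apply.
Qed.

Variable P : set M.
Hypothesis cP : compact P.
Hypothesis sP : forall K, minimal_set phi K -> K `<=` P -> lyapunov_stable phi K.

Let clP : closed P.
Proof. by apply: compact_closed => //; exact: metric_hausdorff. Qed.

(** The limit set contains a minimal set, stable since it lies in [P], hence is
equal to it. *)
Lemma omega_trapped x : (forall t, 0 <= t -> P (phi t x)) ->
  [/\ minimal_set phi (omega_limit phi x), compact (omega_limit phi x) &
      omega_limit phi x `<=` P].
Proof.
move=> Px.
have wP : omega_limit phi x `<=` P by exact: omega_sub Px.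
have cw : compact (omega_limit phi x).
  by apply: subclosed_compact cP wP; exact: omega_closed.
split => //.
have [|L Lw mL] := exists_minimal cw _ (omega_invariant fphi).
  exact: omega_nonempty Px.
rewrite (@omega_stable L)//.
by apply: sP => // y /Lw /wP.
Qed.

(** The backward limit set of [x] contains a minimal set [K].  If [x] were not in
[K], a positively invariant neighbourhood of [K] avoiding [x] would contain a
point of the backward orbit of [x], and then [x] itself. *)
Lemma backward_trapped x : (forall t, t <= 0 -> P (phi t x)) ->
  exists K, [/\ minimal_set phi K, K `<=` P & K x].
Proof.
move=> Px; pose psi t := phi (- t).
have fpsi : flow psi := flow_opp fphi.
have Ppsi t : 0 <= t -> P (psi t x) by move=> t0; apply: Px; rewrite oppr_le0.
have wP : omega_limit psi x `<=` P by exact: omega_sub Ppsi.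
have cw : compact (omega_limit psi x).
  by apply: subclosed_compact cP wP; exact: omega_closed.
have [||L Lw mL] := @exists_minimal _ _ phi _ cw.
- exact: omega_nonempty Ppsi.
- move=> y t wy; rewrite -[t]opprK.
  exact: (omega_invariant fpsi).
have LP : L `<=` P by move=> y /Lw /wP.
exists L; split => //.
have [[l Ll] cL _ _] := mL.
apply: contrapT => nLx.
have ox : open (~` [set x]).
  apply: closed_openC; apply: compact_closed; first exact: metric_hausdorff.
  exact: compact_set1.
have [|V [Vx LV iV]] := sP mL LP (N := ~` [set x]).
  move=> y Ly; apply: open_nbhs_nbhs; split => //= yx.
  by apply: nLx; rewrite -yx.
have [_ [[s /= s0 <-] Vs]] := Lw _ Ll 0 (lexx _) _
  (open_nbhs_nbhs (conj (open_interior V) (LV _ Ll))).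
apply: (Vx x) => //; rewrite -(flowN s x fphi); apply: iV => //.
exact: interior_subset Vs.
Qed.

End Stability.

Section HausdorffNear.
Context {R : realType} {M : metricType R}.

Lemma hausdorff_dist_le (A B : compacts M) (e : R) : 0 < e ->
  (A : set M) `<=` thickening B e -> (B : set M) `<=` thickening A e ->
  mdist A B <= e.
Proof.
move=> e0 AB BA; apply: (@ge_inf R (hausdorff_radii A B)); last by split.
by exists 0 => r [/ltW].
Qed.

(** Every orbit in [K] is dense in [K], so an orbit starting near [K] comes
[e]-close to every point of [K], by continuity and compactness.  An invariant
set near [K] thus has [K] in its thickening, while the other inclusion only
says that it is near [K]. *)
Lemma minimal_hausdorff_nbhd (phi : R -> M -> M) (K : compacts M) (e : R) :
  flow phi -> minimal_set phi K -> 0 < e ->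
  exists O : set M, [/\ open O, (K : set M) `<=` O &
    forall L : compacts M, Defs.invariant phi L -> (L : set M) `<=` O ->
      mdist K L <= e].
Proof.
move=> fphi [_ cK iK mK] e0.
have e20 : 0 < e / 2 by rewrite divr_gt0.
pose Q y := (exists2 k, (K : set M) k & ball k e y) /\
  (K : set M) `<=` (fun z => exists t, ball z e (phi t y)).
exists [set y | Q y]°; split; first exact: open_interior.
  move=> x Kx; apply: filterI.
    by apply: filterS (nbhsx_ballx x e e0) => y; exists x.
  have /compact_near_coveringP cvK := @compacts_compact _ _ K.
  apply: (cvK M (nbhs x) (fun y z => exists t, ball z e (phi t y))) => z Kz.
  have orbK : closure (range (phi^~ x)) = K.
    apply: mK.
    - by exists x; apply: subset_closure; exists 0 => //; case: fphi.
    - exact: closed_closure.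
    - apply: closure_invariant => // _ t [s _ <-]; exists (s + t) => //.
      by case: fphi.
    - by apply: closure_min => // _ [t _ <-]; exact: iK.
  have : closure (range (phi^~ x)) z by rewrite orbK.
  move=> /(_ _ (nbhsx_ballx _ _ e20)) [_ [[t _ <-] zt]].
  (* The radius that keeps the orbit within [e / 2] of [z]. *)
  have nt : nbhs (phi t x) (ball (phi t x) ((e / 2 - mdist z (phi t x)))).
    by apply: nbhsx_ballx; rewrite subr_gt0; move: zt; rewrite ballEmdist.
  exists (ball z (e / 2), [set y | ball z (e / 2) (phi t y)]).
    split => /=; first exact: nbhsx_ballx.
    apply: (filterS _ (flow_continuous fphi nt)) => y /=.
    rewrite !ballEmdist/= => h.
    apply: (le_lt_trans (metric_triangle _ (phi t x) _)); lra.
  move=> [z' y] /= [zz' zy]; exists t; rewrite [e]splitr.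
  by apply: (ball_triangle (ball_sym zz')).
move=> L iL LQ; apply: hausdorff_dist_le => //.
  have [l Ll] := @compacts_nonempty _ _ L.
  move=> z Kz; have [_ /(_ z Kz)[t zt]] := interior_subset (LQ l Ll).
  by exists (phi t l); [exact: iL|exact: ball_sym].
by move=> l /LQ/interior_subset[[k Kk kl] _]; exists k.
Qed.

End HausdorffNear.

(** * The limit set as a continuous map *)

Lemma within_continuous_comp (X Y Z : topologicalType) (A : set X) (B : set Y)
    (f : X -> Y) (g : Y -> Z) :
  (forall x, A x -> B (f x)) -> {within A, continuous f} ->
  {within B, continuous g} -> {within A, continuous (g \o f)}.
Proof.
move=> AB /subspace_continuousP cf /subspace_continuousP cg.
apply/subspace_continuousP => x Ax W /(cg _ (AB x Ax)).
rewrite /nbhs/= /within/= => nB.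
have := cf x Ax _ nB; rewrite /nbhs/= /within/=.
by apply: filterS => y h Ay; exact: (h Ay (AB y Ay)).
Qed.

Section OmegaMap.
Context {R : realType} {M : metricType R}.

Lemma compacts_inj (A B : compacts M) : (A : set M) = B -> A = B.
Proof.
move: A B => [A cA nA] [B cB nB] /= AB; case: _ / AB cB nB => cB nB.
by congr Compacts; exact: Prop_irrelevance.
Qed.

(** The limit set as a point of the Hausdorff space; the value [K0] is taken where
the limit set is not compact and nonempty. *)
Definition omega_map (phi : R -> M -> M) (K0 : compacts M) (x : M) : compacts M :=
  match pselect (compact (omega_limit phi x)),
        pselect (omega_limit phi x !=set0) with
  | left c, left n => Compacts c n
  | _, _ => K0
  end.

Lemma omega_mapE phi K0 x : compact (omega_limit phi x) ->
  omega_limit phi x !=set0 -> (omega_map phi K0 x : set M) = omega_limit phi x.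
Proof. by rewrite /omega_map; case: pselect => // ?; case: pselect. Qed.

(** By stability, the limit sets of points near [x] lie in a small neighbourhood
of that of [x]; by [minimal_hausdorff_nbhd] they are then close to it in the
Hausdorff metric. *)
Lemma omega_map_continuous phi (K0 : compacts M) (P : set M) : flow phi ->
  compact P ->
  (forall K, minimal_set phi K -> K `<=` P -> lyapunov_stable phi K) ->
  {within [set x | forall t, 0 <= t -> P (phi t x)],
    continuous (omega_map phi K0)}.
Proof.
move=> fphi cP sP; apply/subspace_continuousP => x Px.
apply/cvg_ballP => e e0.
have omE y : (forall t, 0 <= t -> P (phi t y)) ->
    (omega_map phi K0 y : set M) = omega_limit phi y.
  move=> /(omega_trapped fphi cP sP)[[n0 _ _ _] cw _].
  exact: omega_mapE.
have [mw cw wP] := omega_trapped fphi cP sP Px.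
have e20 : 0 < e / 2 by rewrite divr_gt0.
have [|O [oO wO near_w]] :=
  minimal_hausdorff_nbhd (K := omega_map phi K0 x) fphi _ e20.
  by rewrite omE.
rewrite omE// in wO.
have [|B [s [cB BO nB]]] :=
  stable_attracts fphi (@omega_closed _ _ phi x) (sP _ mw wP) oO wO (x := x).
  by rewrite setIid; case: mw.
rewrite /within/= nearE /=.
apply: filterS nB => y yB Py.
rewrite ballEmdist/=; apply: (@le_lt_trans _ _ (e / 2)).
  apply: near_w; rewrite omE//; first exact: omega_invariant.
  by apply: subset_trans BO; exact: omega_sub yB.
by rewrite ltr_pdivrMr// ltr_pMr// ltr1n.
Qed.

(** The times spent in [U] form a closed half-line unbounded above; [T] is its
infimum. *)
Lemma entry_time (phi : R -> M -> M) (U : set M) (x : M) (t0 : R) : flow phi ->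
  closed U -> pos_invariant phi U -> U x -> ~ U (phi t0 x) ->
  exists2 T : R, T <= 0 & (forall t, t < T -> ~ U (phi t x)) /\
    (forall t, T <= t -> U (phi t x)).
Proof.
move=> fphi cU iU Ux nUt0.
pose J := [set t | U (phi t x)].
have up s t : J s -> s <= t -> J t.
  move=> Js st; rewrite /J/=; have -> : phi t x = phi (t - s) (phi s x).
    by case: fphi => _ _ <-; rewrite addrC subrK.
  by apply: iU => //; rewrite subr_ge0.
have J0 : J 0 by rewrite /J/=; case: fphi => _ -> _.
have lbJ : lbound J t0.
  move=> t Jt; rewrite leNgt; apply/negP => tt0; apply: nUt0.
  exact: up Jt (ltW tt0).
have hJ : has_inf J by split; [exists 0|exists t0].
have cJ : closed J.
  apply: preimage_closed => // t _; exact: orbit_continuous.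
exists (inf J); first by apply: ge_inf => //; exists t0.
split=> t.
  move=> tT Jt; have : inf J <= t by apply: ge_inf => //; exists t0.
  by rewrite leNgt tT.
apply: up; apply: cJ => W /nbhs_ballP[e /= e0 eW].
have [s Js sT] := inf_adherent e0 hJ.
exists s; split => //; apply: eW; rewrite /ball/=.
have sT' : inf J <= s by apply: ge_inf => //; exists t0.
by rewrite distrC ger0_norm ?subr_ge0// ltrBlDl.
Qed.

End OmegaMap.

(** * The trichotomy *)

Theorem mainTheorem2 (R : realType) (n : nat) (M : metricType R)
    (phi : R -> M -> M) (Lam : compacts M) :
  manifold n M ->
  connected [set: M] ->
  flow phi ->
  minimal_set phi Lam ->
  [\/ exists L : nat -> compacts M,
        (forall k, minimal_set phi (L k) /\ ~ lyapunov_stable phi (L k)) /\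
        L k @[k --> \oo] --> Lam,
      attractor phi Lam |
      forall N : set M, Lam `<=` N^° ->
      exists U : set M,
        [/\ [/\ U `<=` N, Lam `<=` U^°, compact U, connected U &
                pos_invariant phi U],
            [/\ forall K : set M, minimal_set phi K -> K `<=` U ->
                  lyapunov_stable phi K,
                peano_continuum (minimal_sets_in phi U) &
                (minimal_sets_in phi U #= [set: R])%card] &
            forall x, U x ->
              [/\ compact (omega_limit phi x),
                  minimal_set phi (omega_limit phi x),
                  omega_limit phi x `<=` U,
                  lyapunov_stable phi (omega_limit phi x) &
                  ~ omega_limit phi x x ->
                  exists2 T : R, T <= 0 &
                    (forall t, t < T -> ~ U (phi t x)) /\
                    (forall t, T <= t -> U (phi t x))]]].
Proof.
move=> mM _ fphi mLam.
have [H1|H1] := pselect (exists L : nat -> compacts M,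
  (forall k, minimal_set phi (L k) /\ ~ lyapunov_stable phi (L k)) /\
  L k @[k --> \oo] --> Lam); first exact: Or31.
have [H2|H2] := pselect (attractor phi Lam); first exact: Or32.
apply: Or33 => N LamN.
have [d d0 dstab] : exists2 d : R, 0 < d & forall K : compacts M,
    minimal_set phi K -> mdist Lam K < d -> lyapunov_stable phi K.
  apply: contrapT => nd; apply: H1.
  have ex (k : nat) : exists K : compacts M, [/\ minimal_set phi K,
      ~ lyapunov_stable phi K & mdist Lam K < k.+1%:R^-1].
    apply: contrapT => nK; apply: nd; exists k.+1%:R^-1.
      by rewrite invr_gt0 ltr0n.
    move=> K mK dK; apply: contrapT => uK; apply: nK; by exists K.
  have [L LP] := choice ex; exists L; split.
    by move=> k; case: (LP k).
  apply/cvg_ballP => e e0; near=> k.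
  rewrite ballEmdist/=; case: (LP k) => _ _ /lt_trans; apply.
  by near: k; exact: near_infty_natSinv_lt (PosNum e0).
have sLam : lyapunov_stable phi Lam by apply: dstab => //; rewrite mdistxx.
(* Half of [d], since the bound on the distance below is not strict. *)
have [|O [oO LamO nO]] := minimal_hausdorff_nbhd (e := d / 2) fphi mLam.
  by rewrite divr_gt0.
have cLam := @compacts_compact _ _ Lam.
have [||D0 [C0 [g0 []]]] := @cell_cover R n M Lam (O `&` N°) mM cLam.
- by apply: openI => //; exact: open_interior.
- by move=> x Lx; split; [exact: LamO|exact: LamN].
set P := \bigcup_(x in _) _ => D0P cP LamP.
have PON : P `<=` O `&` N°.
  by move=> x [y /D0P[_ [_ _ _ + _]]]; apply.
have clP : closed P by apply: compact_closed => //; exact: metric_hausdorff.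
have sP K : minimal_set phi K -> K `<=` P -> lyapunov_stable phi K.
  move=> mK KP; have [nK cK iK _] := mK.
  have ccK : compact K by exact: subclosed_compact cP KP.
  apply: (dstab (Compacts ccK nK)) => //.
  apply: (@le_lt_trans _ _ (d / 2)).
    by apply: nO => //= x /KP /PON[].
  by rewrite ltr_pdivrMr// ltr_pMr// ltr1n.
have [V [VP LamV iV]] := sLam P LamP.
have [D [C [g []]]] := @cell_cover R n M Lam V° mM cLam (open_interior _) LamV.
set Q := \bigcup_(x in _) _ => DQ cQ LamQ.
have QV : Q `<=` V.
  by move=> x [y /DQ[_ [_ _ _ h _]] /h /interior_subset].
have LamsubQ : (Lam : set M) `<=` Q by move=> x /LamQ/interior_subset.
(* [Q] is [Lam] with cells attached to it. *)
have cnQ : connected Q.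
  have -> : Q = (Lam : set M) `|` Q by rewrite setUidr.
  apply: connected_bouquet; first exact: minimal_connected mLam.
  move=> x /DQ[Lx [_ cvx gc _ gx]]; split; last by exists x.
  by apply: connected_continuous_connected gc; exact: convex_connected.
pose E := [set x | forall t, 0 <= t -> P (phi t x)].
have VE : V `<=` E by move=> x Vx t t0; apply: VP; exact: iV.
have EP : E `<=` P by move=> x /(_ 0 (lexx _)); case: fphi => _ -> _.
have clE : closed E.
  have -> : E = \bigcap_(t in [set t | 0 <= t]) (phi t @^-1` P) by [].
  apply: closed_bigI => t _; apply: preimage_closed => // x _.
  exact: flow_continuous.
(* The forward orbit of [Q], written as [Q] with orbits attached to it. *)
pose S := Q `|` \bigcup_(x in Q) ((phi^~ x) @` `[0, +oo[).
have SV : S `<=` V.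
  move=> x [/QV//|[y /QV Vy [t t0 <-]]].
  by apply: iV => //; move: t0; rewrite /= in_itv/= andbT.
have cnS : connected S.
  apply: connected_bouquet => // x Qx; split.
    apply: connected_continuous_connected.
      by apply/connected_intervalP; exact: interval_is_interval.
    by apply: continuous_subspaceT; exact: orbit_continuous.
  exists x; split => //; exists 0; first by rewrite /= in_itv/= lexx.
  by case: fphi.
have iS : pos_invariant phi S.
  move=> x t Sx t0; right; case: Sx => [Qx|[y Qy [s s0 <-]]].
    by exists x => //; exists t => //; rewrite /= in_itv/= andbT.
  exists y => //; exists (s + t); last by case: fphi.
  by move: s0; rewrite /= !in_itv/= !andbT => s0; exact: addr_ge0.
pose U := closure S.
have iU : pos_invariant phi U by exact: closure_pos_invariant.
have UE : U `<=` E by apply: closure_min => // x /SV /VE.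
have UP : U `<=` P by move=> x /UE /EP.
have cU : compact U by apply: subclosed_compact cP UP; exact: closed_closure.
have QU : Q `<=` U by move=> x Qx; apply: subset_closure; left.
have QE : Q `<=` E by move=> x /QU /UE.
pose om := omega_map phi Lam.
have omE x : E x -> (om x : set M) = omega_limit phi x.
  move=> /(omega_trapped fphi cP sP)[[n0 _ _ _] cw _].
  exact: omega_mapE.
have com : {within E, continuous om} by exact: omega_map_continuous.
have comQ : {within Q, continuous om} by exact: continuous_subspaceW com.
have comQc : compact (om @` Q) by exact: continuous_compact.
(* The limit set is constant along orbits, so [S] has the limit sets of [Q]. *)
have omS x : S x -> (om @` Q) (om x).
  case=> [Qx|[y Qy [t t0 <-]]]; first by exists x.
  have Ey := QE _ Qy.
  have t0' : 0 <= t by move: t0; rewrite /= in_itv/= andbT.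
  have Ety : E (phi t y).
    by apply: VE; apply: iV => //; exact: QV.
  exists y => //; apply: compacts_inj; rewrite !omE//.
  have [[_ _ _ my] _ _] := omega_trapped fphi cP sP Ey.
  have [[nty cty ity _] _ _] := omega_trapped fphi cP sP Ety.
  by symmetry; apply: my => //; exact: omega_shift.
(* The image of [Q] is closed, so by continuity nothing is added in the closure. *)
have omU x : U x -> (om @` Q) (om x).
  move=> Ux; have clQ : closed (om @` Q).
    by apply: compact_closed => //; exact: metric_hausdorff.
  apply: clQ => W nW.
  have /subspace_continuousP/(_ x (UE x Ux)) cx := com.
  move: nW => /cx; rewrite /nbhs/= /within/= => nx.
  have [y [Sy Wy]] := Ux _ nx.
  by exists (om y); split; [exact: omS|apply: Wy; apply: VE; exact: SV].
have wU x : U x -> omega_limit phi x `<=` U.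
  move=> Ux; apply: (@omega_sub _ _ _ _ _ 0) => [|t]; last exact: iU.
  exact: closed_closure.
have minU : minimal_sets_in phi U = om @` Q.
  apply/seteqP; split => [K [mK KU]|_ [x Qx <-]].
    have [k Kk] := @compacts_nonempty _ _ K.
    have -> : K = om k; last by apply: omU; exact: KU.
    apply: compacts_inj; rewrite omE; last by apply: UE; exact: KU.
    by rewrite (omega_minimal fphi mK (@compacts_compact _ _ K)).
  have Ex := QE _ Qx.
  split; rewrite omE//; first by have [] := omega_trapped fphi cP sP Ex.
  by apply: wU; exact: QU.
have LamU : (Lam : set M) `<=` U°.
  by move=> x /LamQ; apply: interiorS.
have LamMin : minimal_sets_in phi U Lam.
  by split => // x /LamU /interior_subset.
have cnMin : connected (minimal_sets_in phi U).
  by rewrite minU; exact: connected_continuous_connected.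
(* Otherwise [Lam] would attract all of [U]. *)
have [K1 [K1min LamK1]] : exists K1, minimal_sets_in phi U K1 /\ Lam <> K1.
  apply: contrapT => nK1; apply: H2; split => //.
  move=> x /LamU; apply: interiorS => y Uy.
  have Ey := UE _ Uy.
  have [[nw _ _ _] _ _] := omega_trapped fphi cP sP Ey.
  split => //; rewrite -omE//.
  have -> // : om y = Lam.
  apply: contrapT => ne; apply: nK1; exists (om y); split; last by move=> /esym.
  by rewrite minU; exact: omU.
exists U; split.
- split => //.
  + by move=> x /UP /PON[_ /interior_subset].
  + exact: connected_closure.
- split.
  + by move=> K mK KU; apply: sP => // x /KU /UP.
  + split => //; first by rewrite minU.
    rewrite minU.
    have -> : om @` Q = \bigcup_(x in [set` D]) ((om \o g x) @` C x).
      by rewrite image_bigcup; apply: eq_bigcupr => x _; rewrite image_comp.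
    apply: locally_connected_image; first exact: metric_hausdorff.
    move=> x Dx; have [_ [cC vC gC _ _]] := DQ x Dx; split => //.
      exact: convex_locally_connected.
    apply: (@within_continuous_comp _ _ _ _ Q) => // v Cv.
    by exists x => //; exists v.
  + rewrite card_eq_le; apply/andP; split; last first.
      exact: connected_card_ge cnMin LamMin K1min LamK1.
    apply: card_le_trans (separable_card_le mM.1).
    have ex (K : compacts M) : exists x, (K : set M) x by exact: compacts_nonempty.
    have [f fP] := choice ex.
    have [h] : $|{injfun minimal_sets_in phi U >-> [set: M]}|.
      apply/injfunPex; exists f => // K L /set_mem[mK _] /set_mem[mL _] fKL.
      apply: compacts_inj; apply: (minimal_meet mK mL).
      by exists (f K); split => //; rewrite fKL.
    exact: inj_card_le h.
- move=> x Ux; have Ex := UE _ Ux.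
  have [mw cw wP] := omega_trapped fphi cP sP Ex.
  split => //; [exact: wU|exact: sP|move=> nwx].
  have [t0 nUt0] : exists t0, ~ U (phi t0 x).
    apply: contrapT => nt0; apply: nwx.
    have sU K : minimal_set phi K -> K `<=` U -> lyapunov_stable phi K.
      by move=> mK KU; apply: sP => // y /KU /UP.
    have [t _|K [mK KU Kx]] := backward_trapped fphi cU sU (x := x).
      by apply: contrapT => nt; apply: nt0; exists t.
    have cK : compact K.
      by apply: subclosed_compact cU KU; case: mK.
    by rewrite (omega_minimal fphi mK cK Kx).
  by apply: entry_time nUt0 => //; exact: closed_closure.
Unshelve. all: by end_near. Qed.
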